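(* Fix a prime power $q$ and an integer $t\ge2$ (so $d=2t\ge4$), and assume $n\ge 6t$. Let $V=\mathbb F_q^n$ and let $\mathcal F$ be a family of subspaces of $V$ with $\mathrm{diam}(\mathcal F)\le 2t$ such that $\mathcal F\not\subseteq\mathcal B(X,t)$ for every subspace $X$ of $V$. Then \[ |\mathcal F|<\sum_{i=0}^{t-1}\begin{bmatrix} n\\ i\end{bmatrix}_q+(2t+1)q^2\begin{bmatrix} 3t\\ t\end{bmatrix}_q\begin{bmatrix} n\\ t-1\end{bmatrix}_q. \]
   Context: $V=\mathbb F_q^n$; $\mathcal V$ is the set of all subspaces of $V$; $\begin{bmatrix} N\\ k\end{bmatrix}_q=\prod_{i=0}^{k-1}\frac{q^{N-i}-1}{q^{k-i}-1}$ is the Gaussian binomial coefficient. $\Delta(U,W)=\dim(U+W)-\dim(U\cap W)$; $\mathrm{diam}(\mathcal F)=\max\{\Delta(U,W):U,W\in\mathcal F\}$; $\mathcal B(C,r)=\{A\in\mathcal V:\Delta(A,C)\le r\}$. *)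

(* Defs.v *)
From HB Require Import structures.
From mathcomp Require Import all_boot all_order all_algebra.

Set Implicit Arguments.
Unset Strict Implicit.
Unset Printing Implicit Defensive.

Import GRing.Theory VectorInternalTheory.
Local Open Scope ring_scope.

(* The library makes {vspace vT} a choiceType only; over a finite field it is
   finite, being a subtype of a type of square matrices (the isSub instance
   lives in VectorInternalTheory). *)
HB.instance Definition _ (F : finFieldType) (vT : vectType F) :=
  [Countable of {vspace vT} by <:].
HB.instance Definition _ (F : finFieldType) (vT : vectType F) :=
  [Finite of {vspace vT} by <:].

(* For k > N the factor i = N vanishes, so the truncated N - i is harmless. *)
Definition gauss_binom (q N k : nat) : rat :=
  \prod_(i < k) ((q%:R ^+ (N - i) - 1) / (q%:R ^+ (k - i) - 1)).

Section SubspaceDistance.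

Variables (F : finFieldType) (vT : vectType F).
Implicit Types (U W C : {vspace vT}) (Fam : {set {vspace vT}}).

(* The subtraction never truncates, since U :&: W <= U + W. *)
Definition sdist U W : nat := (\dim (U + W) - \dim (U :&: W))%N.

Definition sdiam Fam : nat := (\max_(U in Fam) \max_(W in Fam) sdist U W)%N.

Definition sball C (r : nat) : {set {vspace vT}} :=
  [set A : {vspace vT} | (sdist A C <= r)%N].

End SubspaceDistance.

(* Main.v *)
(** Every interval [P, Q] of the subspace lattice is gated: A has a gate
    A' = P + (Q :&: A) with sdist A U = sdist A A' + sdist A' U for all U in the
    interval.  Take U1, U2 in the family at maximal distance; the gate X of any
    member A in the interval I they span satisfies sdist A X <= t.  If
    sdist A X = t, choose W in the family outside the ball of radius t about X;
    sdist A W <= 2t forces the gate of A in the interval spanned by X and W to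
    differ from X, so some Y adjacent to X in that interval has
    sdist A Y <= t - 1.  Hence the family is covered by |I| * q^(3t) balls of
    radius t - 1.  Vandermonde's identity bounds the sphere of radius s by
    [n, s]_q, so each ball has at most 3/2 [n, t-1]_q elements, while
    |I| <= 3 [2t, t]_q; and q^(t^2) [2t, t]_q <= [3t, t]_q, t^2 + 2 >= 3t,
    9/2 < 2t + 1. *)

Require Import Defs.
From HB Require Import structures.
From mathcomp Require Import all_boot all_order all_algebra all_field.
From mathcomp Require Import zify ring lra.

Set Implicit Arguments.
Unset Strict Implicit.
Unset Printing Implicit Defensive.

Import Order.TTheory GRing.Theory Num.Theory.
Local Open Scope ring_scope.

(** * Distances, gates and neighbours in the subspace lattice *)

Section Gates.

Variables (F : finFieldType) (vT : vectType F).
Implicit Types A U W P Q X Y : {vspace vT}.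

(** Additive form free of truncated subtraction, so that [lia] can combine several distances. *)
Lemma sdist_dim U W :
  (sdist U W + 2 * \dim (U :&: W) = \dim U + \dim W)%N.
Proof.
have := dimv_sum_cap U W.
have : (\dim (U :&: W) <= \dim (U + W))%N.
  by apply: dimvS; apply: subv_trans (capvSl _ _) (addvSl _ _).
by rewrite /sdist; lia.
Qed.

Lemma sdistC U W : sdist U W = sdist W U.
Proof. by rewrite /sdist addvC capvC. Qed.

(** [X :&: U] and [X :&: W] lie in [X] and meet inside [U :&: W]; the dimension formula for their
    sum then gives the bound. *)
Lemma sdist_triangle X U W : (sdist U W <= sdist X U + sdist X W)%N.
Proof.
have := sdist_dim U W; have := sdist_dim X U; have := sdist_dim X W.
have := dimv_sum_cap (X :&: U) (X :&: W).
have : (\dim (X :&: U + X :&: W) <= \dim X)%N.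
  by apply: dimvS; rewrite subv_add !capvSl.
have : (\dim ((X :&: U) :&: (X :&: W)) <= \dim (U :&: W))%N.
  by apply: dimvS; rewrite capvS ?capvSr.
by lia.
Qed.

Lemma sdist_interval P Q U W :
  (P <= U)%VS -> (U <= Q)%VS -> (P <= W)%VS -> (W <= Q)%VS ->
  (sdist U W <= \dim Q - \dim P)%N.
Proof.
move=> PU UQ PW WQ.
have : (\dim (U + W) <= \dim Q)%N by apply: dimvS; rewrite subv_add UQ.
have : (\dim P <= \dim (U :&: W))%N by apply: dimvS; rewrite subv_cap PU.
by rewrite /sdist; lia.
Qed.

(** For [P <= Q] this is also [Q :&: (P + A)], by modularity. *)
Definition gate P Q A := (P + Q :&: A)%VS.

Lemma gate_ge P Q A : (P <= gate P Q A)%VS.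
Proof. exact: addvSl. Qed.

Lemma gate_le P Q A : (P <= Q)%VS -> (gate P Q A <= Q)%VS.
Proof. by move=> PQ; rewrite subv_add PQ capvSl. Qed.

(* This is where modularity of the subspace lattice enters. *)
Lemma sdist_gate P Q A U : (P <= U)%VS -> (U <= Q)%VS ->
  sdist A U = (sdist A (gate P Q A) + sdist (gate P Q A) U)%N.
Proof.
move=> PU UQ; have PQ := subv_trans PU UQ.
(* With the meets of the gate with [U] and with [A] explicit, all three distances become dimension
   counts. *)
have capU : (U :&: gate P Q A = U :&: A + P)%VS.
  by rewrite /gate addvC -(vspace_modr _ PU) capvA (capv_idPl UQ).
have capA : (A :&: gate P Q A = Q :&: A)%VS.
  apply/eqP; rewrite eqEsubv !subv_cap capvSl capvSr addvSr !andbT.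
  exact: subv_trans (capvSr _ _) (gate_le _ PQ).
have capUP : (U :&: A :&: P = P :&: A)%VS.
  by rewrite capvC capvA (capv_idPl PU).
have := sdist_dim A U; have := sdist_dim A (gate P Q A).
have := sdist_dim (gate P Q A) U; rewrite (capvC _ U) capU capA.
have := dimv_sum_cap (U :&: A) P; rewrite capUP (capvC A U).
have := dimv_sum_cap P (Q :&: A); rewrite capvA (capv_idPl PQ).
have : (\dim (U :&: A) <= \dim (U :&: A + P))%N by apply/dimvS/addvSl.
by rewrite -/(gate P Q A); lia.
Qed.

Lemma dim_add_line U v : v \notin U -> \dim (U + <[v]>) = (\dim U).+1.
Proof.
move=> vU; have := dimv_sum_cap U <[v]>%VS; rewrite dim_vline.
have -> : v != 0 by apply: contraNneq vU => ->; rewrite mem0v.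
suff -> : (U :&: <[v]>)%VS = 0%VS by rewrite dimv0; lia.
apply/eqP; rewrite -subv0; apply/subvP => w /memv_capP [wU /vlineP [k kw]].
have [k0|k0] := eqVneq k 0; first by rewrite kw k0 scale0r mem0v.
by case/negP: vU; rewrite -(scale1r v) -(mulVf k0) -scalerA -kw memvZ.
Qed.

(** Add to [U] a complement in [X] of [U + <[v]>], where [v] is a vector of [X] outside [U]. *)
Lemma hyperplane_exists U X : (U <= X)%VS -> ~~ (X <= U)%VS ->
  exists H, [/\ (U <= H)%VS, (H <= X)%VS & (\dim H).+1 = \dim X].
Proof.
move=> UX /subvPn [v vX vU]; set Z := (U + <[v]>)%VS.
have ZX : (Z <= X)%VS by rewrite subv_add UX -memvE.
have dZ : \dim Z = (\dim U).+1 := dim_add_line vU.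
exists (U + (X :\: Z))%VS; split; first exact: addvSl.
  by rewrite subv_add UX diffvSl.
have /dimv_disjoint_sum -> : (U :&: (X :\: Z))%VS = 0%VS.
  apply/eqP; rewrite -subv0 -(capv_diff X Z) subv_cap capvSr /=.
  exact: subv_trans (capvSl _ _) (addvSl _ _).
by have := dimv_cap_compl X Z; rewrite (capv_idPr ZX); lia.
Qed.

(** [X] itself is kept so that one cover also handles the [A] already within [t - 1] of [X]. *)
Definition neighbours X W : {set {vspace vT}} :=
  [set Y : {vspace vT} |
     [|| Y == X,
         [&& (X <= Y)%VS, (Y <= X + W)%VS & \dim Y == (\dim X).+1] |
         [&& (X :&: W <= Y)%VS, (Y <= X)%VS & (\dim Y).+1 == \dim X]]].

(** The gate [Y] of [A] between [X :&: W] and [X + W] differs from [X], since otherwise the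
    distances would add up. One step from [X] towards [Y], down if [X] is not inside [Y] and up
    otherwise, stays in the interval and gets closer to [Y], hence to [A]. *)
Lemma closer_neighbour A X W :
  (sdist A W < sdist A X + sdist X W)%N ->
  exists2 Y, Y \in neighbours X W & (sdist A Y < sdist A X)%N.
Proof.
move=> hAW.
have PX := capvSl X W; have PW := capvSr X W.
have XQ := addvSl X W; have WQ := addvSr X W.
have PQ := subv_trans PX XQ.
set Y := gate (X :&: W) (X + W) A.
have PY : (X :&: W <= Y)%VS := gate_ge _ _ _.
have YQ : (Y <= X + W)%VS := gate_le A PQ.
have eAX : sdist A X = (sdist A Y + sdist Y X)%N := sdist_gate A PX XQ.
have eAW : sdist A W = (sdist A Y + sdist Y W)%N := sdist_gate A PW WQ.
have nYX : Y != X.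
  by apply/eqP => YX; move: eAX eAW hAW; rewrite YX /sdist; lia.
have [XY|nXY] := boolP (X <= Y)%VS; last first.
  have [||H [UH HX dH]] := @hyperplane_exists (X :&: Y)%VS X.
  - exact: capvSl.
  - by rewrite subv_cap subvv.
  have PH : (X :&: W <= H)%VS.
    by apply: subv_trans UH; rewrite subv_cap PX PY.
  exists H; first by rewrite inE PH HX dH eqxx !orbT.
  rewrite (sdist_gate A PH (subv_trans HX XQ)) -/Y eAX ltn_add2l.
  have := sdist_dim Y H; have := sdist_dim Y X.
  (* [H] contains [X :&: Y], so it meets [Y] exactly as [X] does while having one dimension less. *)
  suff -> : (Y :&: H = Y :&: X)%VS by move: dH; clear; clearbody Y; lia.
  apply/eqP; rewrite eqEsubv !subv_cap !capvSl /= [(Y :&: X)%VS]capvC UH andbT.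
  exact: subv_trans (capvSr _ _) HX.
have /subvPn [v vY vX] : ~~ (Y <= X)%VS.
  by apply: contraNN nYX => YX; rewrite eqEsubv YX.
have HY : (X + <[v]> <= Y)%VS by rewrite subv_add XY -memvE.
have XH : (X <= X + <[v]>)%VS := addvSl _ _.
have HQ := subv_trans HY YQ.
have dH := dim_add_line vX.
exists (X + <[v]>)%VS; first by rewrite inE XH HQ dH eqxx !orbT.
rewrite (sdist_gate A (subv_trans PX XH) HQ) -/Y eAX ltn_add2l.
have := sdist_dim Y (X + <[v]>); have := sdist_dim Y X.
rewrite (capv_idPr HY) (capv_idPr XY) dH.
by have := dimvS HY; rewrite dH; clear; clearbody Y; lia.
Qed.

End Gates.

(** * Identities and estimates for Gaussian binomials *)

Section GaussianBinomials.

Variable q : nat.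
Hypothesis q_gt1 : (1 < q)%N.

Local Notation Q := (q%:R : rat).
Local Notation g := (gauss_binom q).

Lemma q_ge1 : 1 <= Q. Proof. by rewrite ler1n; lia. Qed.

Lemma q_neq0 : Q != 0. Proof. by rewrite pnatr_eq0; lia. Qed.

Lemma qX_subr1_gt0 k : 0 < Q ^+ k.+1 - 1.
Proof. by rewrite subr_gt0 exprn_egt1 // ltr1n. Qed.

Lemma qX_subr1_neq0 k : Q ^+ k.+1 - 1 != 0.
Proof. by rewrite gt_eqF // qX_subr1_gt0. Qed.

Lemma qX_subr1_ge0 k : 0 <= Q ^+ k - 1.
Proof. by rewrite subr_ge0 exprn_ege1 // q_ge1. Qed.

Lemma qX_le a b : (a <= b)%N -> Q ^+ a <= Q ^+ b.
Proof. by move=> ab; rewrite ler_weXn2l // q_ge1. Qed.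

Lemma gauss_n0 N : g N 0 = 1.
Proof. by rewrite /gauss_binom big_ord0. Qed.

Lemma gauss_SS N k :
  g N.+1 k.+1 = (Q ^+ N.+1 - 1) / (Q ^+ k.+1 - 1) * g N k.
Proof. by rewrite /gauss_binom big_ord_recl !subn0. Qed.

Lemma gauss_0S k : g 0 k.+1 = 0.
Proof. by rewrite /gauss_binom big_ord_recl subn0 expr0 subrr !mul0r. Qed.

Lemma gauss_ge0 N k : 0 <= g N k.
Proof.
by apply: prodr_ge0 => i _; rewrite divr_ge0 ?qX_subr1_ge0.
Qed.

Lemma gauss_gt0 N k : (k <= N)%N -> 0 < g N k.
Proof.
elim: k N => [|k IHk] [|N] //; rewrite ?gauss_n0 // => kN.
by rewrite gauss_SS mulr_gt0 ?IHk // divr_gt0 ?qX_subr1_gt0.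
Qed.

(** Ratio of consecutive entries of a row, cross-multiplied; for [k >= N] both sides vanish. *)
Lemma gauss_succ N k :
  g N k.+1 * (Q ^+ k.+1 - 1) = g N k * (Q ^+ (N - k) - 1).
Proof.
elim: k N => [|k IHk] [|N].
- by rewrite gauss_0S subrr mulr0 mul0r.
- by rewrite gauss_SS !gauss_n0 mulr1 mul1r subn0 divfK ?qX_subr1_neq0.
- by rewrite !gauss_0S !mul0r.
rewrite !gauss_SS subSS mulrAC divfK ?qX_subr1_neq0 // -mulrA -IHk.
by field; rewrite qX_subr1_neq0.
Qed.

Lemma gauss_n1_le N : g N 1 <= Q ^+ N - 1.
Proof.
have := gauss_succ N 0; rewrite gauss_n0 mul1r subn0 expr1 => <-.
rewrite ler_peMr ?gauss_ge0 //.
by have : 2 <= Q; [rewrite (ler_nat _ 2) | lra].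
Qed.

Lemma gauss_sym N k : (k <= N)%N -> g N (N - k) = g N k.
Proof.
(* The q-factorial without its normalising power of [Q - 1]. *)
pose fact n := \prod_(i < n) (Q ^+ i.+1 - 1).
have fact_neq0 n : fact n != 0.
  by apply/prodf_neq0 => i _; apply: qX_subr1_neq0.
have factS n : fact n.+1 = fact n * (Q ^+ n.+1 - 1).
  by rewrite /fact big_ord_recr.
have gauss_fact M j : (j <= M)%N -> g M j * (fact j * fact (M - j)%N) = fact M.
  elim: j M => [|j IHj] [|M] // jM.
  - by rewrite gauss_n0 /fact big_ord0 !mul1r.
  - by rewrite gauss_n0 subn0 {1}/fact big_ord0 !mul1r.
  by rewrite gauss_SS subSS !factS -(IHj M) //; field; rewrite qX_subr1_neq0.
move=> kN; apply: (mulIf (fact_neq0 k)); apply: (mulIf (fact_neq0 (N - k)%N)).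
rewrite -!mulrA gauss_fact // [fact k * _]mulrC -{3}(subKn kN).
by rewrite gauss_fact ?leq_subr.
Qed.

Lemma gauss_monoN M N k : (M <= N)%N -> g M k <= g N k.
Proof.
move=> MN; apply: ler_prod => i _.
rewrite divr_ge0 ?qX_subr1_ge0 //= ler_wpM2r ?invr_ge0 ?qX_subr1_ge0 //.
by rewrite lerB // qX_le // leq_sub2r.
Qed.

(** Factor by factor: one [Q ^+ M] goes to each of the [k] numerators, and [Q ^+ M * (Q ^+ (N - i) -
    1) <= Q ^+ (M + N - i) - 1]. *)
Lemma gauss_addN M N k : (k <= N)%N -> Q ^+ (M * k) * g N k <= g (M + N) k.
Proof.
move=> kN; rewrite exprM -[X in _ ^+ X](card_ord k) -prodr_const -big_split /=.
apply: ler_prod => i _; rewrite mulrA.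
rewrite divr_ge0 ?qX_subr1_ge0 ?mulr_ge0 ?exprn_ge0 ?qX_subr1_ge0 //=.
rewrite ler_wpM2r ?invr_ge0 ?qX_subr1_ge0 //.
rewrite mulrBr mulr1 -exprD addnBA; last by have := ltn_ord i; lia.
by rewrite lerB // exprn_ege1 // q_ge1.
Qed.

(** The ratio of the two entries is [(Q ^+ (N - k) - 1) / (Q ^+ k.+1 - 1)], and
    [N - k >= k + 1 + c]. *)
Lemma gauss_ratio N k (c : nat) : (2 * k + c < N)%N ->
  Q ^+ c * g N k <= g N k.+1.
Proof.
move=> kcN; rewrite -(ler_pM2r (qX_subr1_gt0 k)) gauss_succ mulrAC mulrC.
rewrite ler_wpM2l ?gauss_ge0 // mulrBr mulr1 -exprD lerB ?qX_le //; first by lia.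
by rewrite exprn_ege1 // q_ge1.
Qed.

(** Below the middle of a row each entry is at least twice the previous one. *)
Lemma gauss_sum_half m r : (2 * r <= m)%N ->
  \sum_(0 <= j < r) g m j <= g m r.
Proof.
elim: r => [|r IHr] rm; first by rewrite big_geq // gauss_ge0.
rewrite big_nat_recr //=; apply: le_trans (gauss_ratio (c := 1) _); last by lia.
have q2 : 2 <= Q by rewrite (ler_nat _ 2).
have h : \sum_(0 <= j < r) g m j <= g m r by apply: IHr; lia.
by have := gauss_ge0 m r; rewrite expr1; nra.
Qed.

(** After enlarging the row to [2 * t], the entries below the middle sum to at most the middle one,
    and by symmetry so do those above it. *)
Lemma gauss_sum_total m t : (m <= 2 * t)%N ->
  \sum_(0 <= j < m.+1) g m j <= 3 * g (2 * t) t.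
Proof.
move=> mt; set G := g (2 * t).
apply: (@le_trans _ _ (\sum_(0 <= j < (2 * t).+1) G j)).
  rewrite [leRHS](big_cat_nat (n := m.+1)) //=.
  rewrite -[leLHS]addr0 lerD //.
    by apply: ler_sum => j _; apply: gauss_monoN.
  by apply: sumr_ge0 => j _; apply: gauss_ge0.
have low : \sum_(0 <= j < t) G j <= G t by apply: gauss_sum_half.
have high : \sum_(t.+1 <= j < (2 * t).+1) G j = \sum_(0 <= j < t) G j.
  rewrite big_nat_rev /= -{1}[t.+1]add0n big_addn.
  have -> : ((2 * t).+1 - t.+1 = t)%N by lia.
  apply: eq_big_nat => j jt; rewrite /G -[RHS]gauss_sym; last by lia.
  by congr (gauss_binom q _ _); lia.
rewrite (big_cat_nat (n := t)) //=; last by lia.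
rewrite [X in _ + X]big_ltn ?high; last by lia.
by move: low; lra.
Qed.

(** Consecutive ratios are at least [Q ^+ 2 >= 4], and the constant 3/2 reproduces itself:
    [1 + (3/2)/4 <= 3/2]. *)
Lemma gauss_sum_ball n r : (2 * r < n)%N ->
  2 * \sum_(0 <= s < r.+1) g n s <= 3 * g n r.
Proof.
elim: r => [|r IHr] rn; first by rewrite big_nat1 gauss_n0; lra.
rewrite big_nat_recr //= mulrDr.
have h : 2 * \sum_(0 <= j < r.+1) g n j <= 3 * g n r by apply: IHr; lia.
have : Q ^+ 2 * g n r <= g n r.+1 by apply: gauss_ratio; lia.
have : 4 * g n r <= Q ^+ 2 * g n r.
  rewrite ler_wpM2r ?gauss_ge0 // -natrX (ler_nat _ 4).
  by rewrite (leq_sqr 2 q).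
by have := gauss_ge0 n r; lra.
Qed.

End GaussianBinomials.

(** * Counting subspaces: intervals, spheres and balls *)

Section Counting.

Variables (K : finFieldType) (n : nat).
Local Notation V := 'rV[K]_n.
Local Notation q := #|K|.
Local Notation Q := (q%:R : rat).
Local Notation g := (gauss_binom q).
Implicit Types A B E S T U W X Y : {vspace V}.

Lemma q_gt1 : (1 < q)%N. Proof. exact: card_finNzRing_gt1. Qed.

Lemma card_vspaceD B E : (E <= B)%VS ->
  (#|[set v in B | v \notin E]|%:R : rat) = Q ^+ \dim B - Q ^+ \dim E.
Proof.
move=> EB; apply/eqP; rewrite eq_sym subr_eq -!natrX -natrD; apply/eqP.
congr (_%:R); rewrite -!card_vspace.
have -> : [set v in B | v \notin E] = [set v in B] :\: [set v in E].
  by apply/setP => v; rewrite !inE andbC.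
rewrite cardsD (setIidPr _); last by apply/subsetP => v; rewrite !inE; apply/subvP.
rewrite !cardsE subnK //; apply: subset_leq_card.
by apply/subsetP => v; apply: (subvP EB).
Qed.

Lemma extension_line B E X v : (E <= X)%VS -> v \notin X ->
  (B :&: (X + <[v]>) == E + <[v]>)%VS = (B :&: X == E)%VS && (v \in B).
Proof.
move=> EX vX; apply/eqP/andP => [BX1|[/eqP <- vB]].
  have vB : (v \in B)%VS.
    rewrite memvE; apply: subv_trans (capvSl B (X + <[v]>)).
    by rewrite BX1 addvSr.
  split=> //; apply/eqP.
  have -> : (B :&: X = X :&: (E + <[v]>))%VS.
    by rewrite -BX1 capvA [(X :&: B)%VS]capvC -capvA (capv_idPl (addvSl X _)).
  rewrite addvC -(vspace_modr _ EX).
  suff -> : (X :&: <[v]> = 0)%VS by rewrite add0v.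
  apply/eqP; rewrite -dimv_eq0; have := dimv_sum_cap X <[v]>%VS.
  rewrite dim_add_line // dim_vline.
  have -> : v != 0 by apply: contraNneq vX => ->; rewrite mem0v.
  by lia.
by rewrite vspace_modr // -memvE.
Qed.

(* Double counting pairs [(B, v)] with [v \in B] outside [E] replaces [E], [X]
   by [E + <[v]>], [X + <[v]>]. *)
Lemma card_extensions b E X T : (E <= X)%VS -> (X <= T)%VS ->
  (#|[set B | [&& (B <= T)%VS, (B :&: X == E)%VS & \dim B == (\dim E + b)%N]]|%:R
     : rat) =
  Q ^+ (b * (\dim X - \dim E)) * g (\dim T - \dim X) b.
Proof.
elim: b E X => [|b IHb] E X EX XT.
  rewrite mul0n expr0 mul1r gauss_n0 addn0.
  rewrite (_ : [set B | _] = [set E]) ?cards1 //.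
  apply/setP => B; rewrite !inE; apply/and3P/eqP => [[_ /eqP BX /eqP dB]|->].
    by apply/esym/eqP; rewrite eqEdim -{1}BX capvSl dB leqnn.
  by rewrite (subv_trans EX XT) (capv_idPl EX).
set S := [set B | _]; have dEX := dimvS EX; have dXT := dimvS XT.
(* Since [B :&: X = E], the vectors of [B] outside [X] are those outside [E]. *)
have countB B : B \in S ->
    (\sum_(v in T | v \notin X) (v \in B)%:R : rat) =
    Q ^+ (\dim E + b.+1) - Q ^+ \dim E.
  rewrite inE => /and3P [BT /eqP BX /eqP dB].
  rewrite -dB -card_vspaceD -?BX ?capvSl // -sum1_card natr_sum.
  rewrite big_mkcond [RHS]big_mkcond; apply: eq_bigr => v _.
  rewrite !inE memv_cap; have [vB|] := boolP (v \in B); last first.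
    by rewrite /=; case: ifP.
  by rewrite (subvP BT v vB) /=.
(* Passing to [E + <[v]>] and [X + <[v]>] keeps [dim X - dim E] and lowers [dim T - dim X] by
   one. *)
have countv v : v \in T -> v \notin X ->
    (\sum_(B in S) (v \in B)%:R : rat) =
    Q ^+ (b * (\dim X - \dim E)) * g (\dim T - \dim X).-1 b.
  move=> vT vX; have vE : v \notin E by apply: contraNN vX; apply/subvP.
  have := IHb (E + <[v]>)%VS (X + <[v]>)%VS.
  rewrite !dim_add_line // subSS -subn1 -subnDA addn1 => <-; last 2 first.
  - by rewrite addvS.
  - by rewrite subv_add XT -memvE.
  rewrite -sum1_card natr_sum big_mkcond [RHS]big_mkcond; apply: eq_bigr => B _.
  rewrite !inE extension_line // addSnnS.
  by case: (v \in B); rewrite ?andbT ?andbF //=; case: ifP.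
have double : (#|S|%:R : rat) * (Q ^+ (\dim E + b.+1) - Q ^+ \dim E) =
    (Q ^+ \dim T - Q ^+ \dim X) *
    (Q ^+ (b * (\dim X - \dim E)) * g (\dim T - \dim X).-1 b).
  rewrite -card_vspaceD // mulr_natl -sumr_const -(eq_bigr _ countB).
  rewrite exchange_big /= mulr_natl -sumr_const.
  rewrite [RHS](eq_bigl (fun v => (v \in T) && (v \notin X))).
    by apply: eq_bigr => v /andP [vT vX]; apply: countv.
  by move=> v; rewrite inE.
have Q0 := q_neq0 q_gt1.
have pos : Q ^+ (\dim E + b.+1) - Q ^+ \dim E != 0.
  rewrite exprD -{2}[Q ^+ \dim E]mulr1 -mulrBr mulf_neq0 ?expf_neq0 //.
  by rewrite qX_subr1_neq0 // q_gt1.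
apply: (mulIf pos); rewrite {}double.
have eT : \dim T = (\dim X + (\dim T - \dim X))%N by lia.
have eX : \dim X = (\dim E + (\dim X - \dim E))%N by lia.
rewrite {1}eT [X in _ - Q ^+ X]eX {1}eX.
(* If [X] and [T] have equal dimension, no vector is left outside [X] and both sides are zero. *)
case: (_ - \dim X)%N => [|m].
  by rewrite gauss_0S mulr0 mul0r addn0 subrr mul0r.
rewrite gauss_SS mulSn !exprD /=; field.
by rewrite qX_subr1_neq0 ?q_gt1.
Qed.

Lemma card_interval_dim P T j : (P <= T)%VS ->
  (#|[set B | [&& (P <= B)%VS, (B <= T)%VS & \dim B == (\dim P + j)%N]]|%:R : rat)
  = g (\dim T - \dim P) j.
Proof.
move=> PT; have := card_extensions j (subvv P) PT.
rewrite subnn muln0 expr0 mul1r => <-; congr (_%:R).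
apply: eq_card => B; rewrite !inE [LHS]andbCA; congr [&& _, _ & _].
by apply/idP/eqP => [/capv_idPr|<-]; rewrite ?capvSl.
Qed.

Lemma card_interval P T : (P <= T)%VS ->
  (#|[set B : {vspace V} | (P <= B)%VS && (B <= T)%VS]|%:R : rat) =
  \sum_(0 <= j < (\dim T - \dim P).+1) g (\dim T - \dim P) j.
Proof.
move=> PT; set m := (\dim T - \dim P)%N.
rewrite big_mkord -sum1_card natr_sum.
rewrite (partition_big (fun B => inord (\dim B - \dim P) : 'I_m.+1) predT) //=.
apply: eq_bigr => j _; rewrite -card_interval_dim // -sum1_card natr_sum.
apply: eq_bigl => B; rewrite !inE -andbA.
have [PB|] := boolP (P <= B)%VS => //=; have [BT|] := boolP (B <= T)%VS => //=.
have := dimvS PB; have := dimvS BT => dBT dPB.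
rewrite -val_eqE /= inordK; last by rewrite /m; lia.
by apply/eqP/eqP; lia.
Qed.

(** Choose the meet [E] of [A] with [X] first, then extend [E] in the whole space. *)
Lemma card_profile e b X :
  (#|[set A : {vspace V} | (\dim (A :&: X) == e) && (\dim A == (e + b)%N)]|%:R : rat)
  = g (\dim X) e * (Q ^+ (b * (\dim X - e)) * g (n - \dim X) b).
Proof.
have -> : g (\dim X) e = (#|[set E | (E <= X)%VS && (\dim E == e)]|)%:R.
  have := card_interval_dim e (sub0v X); rewrite dimv0 subn0 => <-.
  by congr (_%:R); apply: eq_card => B; rewrite !inE sub0v.
rewrite -sum1_card natr_sum.
rewrite (partition_big (fun A => A :&: X)%VS
           (mem [set E | (E <= X)%VS && (\dim E == e)])) /=; last first.
  by move=> A; rewrite !inE capvSr => /andP [->].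
rewrite mulr_natl -sumr_const; apply: eq_bigr => E.
rewrite inE => /andP [EX /eqP <-].
have := card_extensions b EX (subvf X); rewrite dimvf /dim /= mul1n => <-.
rewrite -sum1_card natr_sum; apply: eq_bigl => A; rewrite !inE subvf /= andbC.
by case: eqP => [->|]; rewrite ?eqxx.
Qed.

(** The s-dimensional subspaces are sorted by the dimension [a] of their meet with [X]. *)
Lemma gauss_vandermonde X s :
  \sum_(a < s.+1)
     g (\dim X) a * (Q ^+ ((s - a) * (\dim X - a)) * g (n - \dim X) (s - a))
  = g n s.
Proof.
have := card_interval_dim s (sub0v (fullv : {vspace V})).
rewrite dimv0 subn0 dimvf /dim /= mul1n => <-; rewrite -[in RHS]sum1_card natr_sum.
rewrite [RHS](partition_big (fun A => inord (\dim (A :&: X)) : 'I_s.+1) predT) //=.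
apply: eq_bigr => a _; rewrite -card_profile -sum1_card natr_sum.
apply: eq_bigl => A; rewrite !inE sub0v subvf /= add0n subnKC; last first.
  by have := ltn_ord a; lia.
rewrite andbC; case: (\dim A =P s) => [dA|//]; rewrite ?andbF ?andbT //.
rewrite -val_eqE /= inordK // ltnS -dA.
exact/dimvS/capvSl.
Qed.

(** Sorting by the codimension [a] of [A :&: X] in [X] gives Vandermonde's sum with exponent
    [(s - a) * a]. Termwise comparison works when [dim X >= 2 * s]; otherwise the complement of [X]
    has dimension at least [2 * s]. *)
Lemma card_sphere X s : (4 * s <= n)%N ->
  (#|[set A : {vspace V} | sdist A X == s]|%:R : rat) <= g n s.
Proof.
move=> sn; have q1 := q_ge1 q_gt1.
have dX : (\dim X <= n)%N.
  by have := dimvS (subvf X); rewrite dimvf /dim /= mul1n.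
have -> : (#|[set A : {vspace V} | sdist A X == s]|%:R : rat) =
    \sum_(a < s.+1 | (a <= \dim X)%N)
      g (\dim X) a * (Q ^+ ((s - a) * a) * g (n - \dim X) (s - a)).
  rewrite -sum1_card natr_sum.
  rewrite (partition_big (fun A => inord (\dim X - \dim (A :&: X)) : 'I_s.+1)
    (fun a : 'I_s.+1 => (a <= \dim X)%N)) /=; last first.
    move=> A; rewrite inE => /eqP dAX; rewrite inordK ?leq_subr // ltnS.
    have := sdist_dim A X; have := dimvS (capvSl A X); rewrite dAX; lia.
  apply: eq_bigr => a aX; have := card_profile (\dim X - a)%N (s - a)%N X.
  rewrite subKn // gauss_sym ?q_gt1 // => <-.
  rewrite -sum1_card natr_sum; apply: eq_bigl => A; rewrite !inE.
  have := sdist_dim A X; have := dimvS (capvSl A X); have := dimvS (capvSr A X).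
  move=> d1 d2 d3; rewrite -val_eqE /=; have := ltn_ord a => as1.
  apply/andP/andP => [[/eqP eAX]|[/eqP h1 /eqP h2]].
    rewrite inordK; last by lia.
    by move/eqP => h; split; apply/eqP; lia.
  by split; [|rewrite inordK]; try apply/eqP; lia.
have [Xbig|Xsmall] := leqP (2 * s) (\dim X).
  rewrite -(gauss_vandermonde X).
  rewrite [leRHS](bigID (fun a : 'I_s.+1 => (a <= \dim X)%N)) /=.
  rewrite -[leLHS]addr0 lerD //.
    apply: ler_sum => a aX; rewrite !ler_wpM2l ?ler_wpM2r ?gauss_ge0 ?q_gt1 //.
    apply: qX_le; rewrite ?q_gt1 // leq_mul2l; have := ltn_ord a; lia.
  by apply: sumr_ge0 => a _; rewrite !mulr_ge0 ?gauss_ge0 ?q_gt1 ?exprn_ge0.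
rewrite -(gauss_vandermonde X^C) dimv_compl dimvf /dim /= mul1n subKn //.
(* Complementing swaps the two binomials, so [a] is replaced by [s - a] to align the terms. *)
rewrite [leRHS](reindex_inj rev_ord_inj) /=.
rewrite [leRHS](bigID (fun a : 'I_s.+1 => (a <= \dim X)%N)) /=.
rewrite -[leLHS]addr0 lerD //.
  apply: ler_sum => a aX; have := ltn_ord a => as1.
  rewrite subSS subKn; last by lia.
  rewrite [leLHS]mulrCA [leRHS]mulrCA [X in _ * X <= _]mulrC.
  rewrite ler_wpM2r ?mulr_ge0 ?gauss_ge0 ?q_gt1 //.
  by apply: qX_le; rewrite ?q_gt1 // mulnC leq_mul2l; lia.
by apply: sumr_ge0 => a _; rewrite !mulr_ge0 ?gauss_ge0 ?q_gt1 ?exprn_ge0.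
Qed.

Lemma card_ball X r : (4 * r < n)%N ->
  2 * (#|[set A : {vspace V} | (sdist A X <= r)%N]|%:R : rat) <= 3 * g n r.
Proof.
move=> rn; apply: le_trans (gauss_sum_ball q_gt1 _); last by lia.
rewrite ler_wpM2l // -sum1_card natr_sum big_mkord.
rewrite (partition_big (fun A => inord (sdist A X) : 'I_r.+1) predT) //=.
apply: ler_sum => s _; apply: le_trans (card_sphere X _); last first.
  by have := ltn_ord s; lia.
rewrite -sum1_card natr_sum le_eqVlt; apply/orP; left; apply/eqP.
apply: eq_bigl => A; rewrite !inE -val_eqE /=; have := ltn_ord s => sr.
apply/andP/eqP => [[dA /eqP]|dA]; first by rewrite inordK.
by rewrite inordK dA //; split; rewrite ?eqxx; lia.
Qed.

End Counting.

(** * Neighbour count, covering bound and conclusion *)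

(** With [a] and [b] the codimensions below and above [X], the count is at most
    [1 + (Q ^+ a - 1) + (Q ^+ b - 1)], which is at most [Q ^+ (a + b)] because
    [(Q ^+ a - 1) * (Q ^+ b - 1) >= 0]. *)
Lemma card_neighbours (K : finFieldType) (n : nat) (X W : {vspace 'rV[K]_n}) :
  (#|neighbours X W|%:R : rat) <= #|K|%:R ^+ sdist X W.
Proof.
have q1 := q_gt1 K; set Q : rat := #|K|%:R.
set a := (\dim X - \dim (X :&: W))%N; set b := (\dim (X + W) - \dim X)%N.
have dPX := dimvS (capvSl X W); have dXQ := dimvS (addvSl X W).
have -> : sdist X W = (a + b)%N by rewrite /sdist /a /b; lia.
pose up := [set Y : {vspace 'rV[K]_n} |
  [&& (X <= Y)%VS, (Y <= X + W)%VS & \dim Y == (\dim X + 1)%N]].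
pose down := [set Y : {vspace 'rV[K]_n} |
  [&& (X :&: W <= Y)%VS, (Y <= X)%VS & (\dim Y).+1 == \dim X]].
have up_le : (#|up|%:R : rat) <= Q ^+ b - 1.
  by rewrite card_interval_dim ?addvSl // gauss_n1_le.
have down_le : (#|down|%:R : rat) <= Q ^+ a - 1.
  have [a0|a_gt0] := posnP a.
    rewrite a0 expr0 subrr (_ : down = set0) ?cards0 //; apply/setP => Y.
    rewrite !inE; apply/negbTE/and3P => -[PY _ /eqP dY].
    by have := dimvS PY; move: a0; rewrite /a; lia.
  apply: le_trans (gauss_n1_le q1 a); rewrite -[leRHS]gauss_sym //.
  rewrite -card_interval_dim ?capvSl // ler_nat subset_leq_card //.
  apply/subsetP => Y; rewrite !inE => /and3P [-> -> /eqP dY] /=.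
  by rewrite -/a; apply/eqP; move: a_gt0; rewrite /a; lia.
have : (#|neighbours X W|%:R : rat) <= 1 + #|up|%:R + #|down|%:R.
  rewrite -(natrD _ 1) -natrD ler_nat.
  have -> : neighbours X W = X |: (up :|: down).
    by apply/setP => Y; rewrite !inE addn1.
  by rewrite cardsU1 cardsU -addnA leq_add ?leq_b1 ?leq_subr.
have : 0 <= (Q ^+ a - 1) * (Q ^+ b - 1) by rewrite mulr_ge0 // qX_subr1_ge0.
by rewrite exprD; lra.
Qed.

Lemma card_cover (T I : finType) (A : {set T}) (B : {set I})
    (C : I -> {set T}) (c : rat) :
  (forall x, x \in A -> exists2 i, i \in B & x \in C i) ->
  (forall i, i \in B -> #|C i|%:R <= c) -> #|A|%:R <= #|B|%:R * c.
Proof.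
move=> covA leC; rewrite mulr_natl -[leRHS]sumr_const.
apply: (@le_trans _ _ (\sum_(i in B) #|C i|%:R)); last exact: ler_sum.
rewrite -natr_sum ler_nat.
apply: (@leq_trans (\sum_(x in A) \sum_(i in B) (x \in C i))).
  rewrite -sum1_card; apply: leq_sum => x /covA [i iB xC].
  by rewrite (bigD1 i) //= xC.
rewrite exchange_big /=; apply: leq_sum => i _.
rewrite -sum1_card [leqLHS]big_mkcond [leqRHS]big_mkcond /=.
by apply: leq_sum => x _; case: (x \in A); case: (x \in C i).
Qed.

Lemma sdist_le_sdiam (F : finFieldType) (vT : vectType F)
    (Fam : {set {vspace vT}}) U W :
  U \in Fam -> W \in Fam -> (sdist U W <= sdiam Fam)%N.
Proof.
move=> UF WF; rewrite /sdiam.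
apply: leq_trans (leq_bigmax_cond (F := fun U => \max_(W in Fam) sdist U W) U UF).
exact: (leq_bigmax_cond (F := sdist U) W WF).
Qed.

(** The closing arithmetic over abstract reals: [3 * (3 / 2) = 9 / 2 <= 5 <= c]. *)
Lemma final_estimate (R : realFieldType) (f i G2 G3 H q3 q2 qt c : R) :
  0 <= H -> 0 <= G2 -> 0 <= q3 -> 0 <= q2 ->
  f <= i * (q3 * (3 / 2 * H)) -> i <= 3 * G2 ->
  qt * G2 <= G3 -> q3 <= q2 * qt -> 5 <= c -> f <= c * q2 * G3 * H.
Proof.
move=> H0 G0 q30 q20 fi i3 G23 q3q c5; apply: (le_trans fi).
apply: (@le_trans _ _ (3 * G2 * (q3 * (3 / 2 * H)))).
  by rewrite ler_wpM2r // !mulr_ge0 // invr_ge0.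
have -> : 3 * G2 * (q3 * (3 / 2 * H)) = 9 / 2 * (q3 * G2) * H by field.
rewrite ler_wpM2r // -[leRHS]mulrA; apply: ler_pM.
- by lra.
- exact: mulr_ge0.
- by lra.
apply: (@le_trans _ _ (q2 * qt * G2)); first by rewrite ler_wpM2r.
by rewrite -mulrA ler_wpM2l.
Qed.

Theorem theorem1p5 (q : nat) (K : finFieldType) (hq : #|K| = q)
    (t n : nat) (ht : (2 <= t)%N) (hn : (6 * t <= n)%N)
    (Fam : {set {vspace 'rV[K]_n}})
    (hdiam : (sdiam Fam <= 2 * t)%N)
    (hball : forall X : {vspace 'rV[K]_n}, ~ (Fam \subset sball X t)) :
  (#|Fam|%:R : rat) <
    \sum_(0 <= i < t) gauss_binom q n i
    + (2 * t + 1)%:R * q%:R ^+ 2 * gauss_binom q (3 * t) t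
      * gauss_binom q n (t - 1).
Proof.
have q1 : (1 < q)%N by rewrite -hq q_gt1.
have far_ex X : exists2 W, W \in Fam & (t < sdist X W)%N.
  have /negP/subsetPn [W WF] := hball X.
  by rewrite inE -ltnNge sdistC; exists W.
(* The default [X] is never taken, as no ball of radius [t] contains the family. *)
pose far X := odflt X [pick W in Fam | (t < sdist X W)%N].
have farP X : far X \in Fam /\ (t < sdist X (far X))%N.
  rewrite /far; case: pickP => [W /andP [] //|none].
  by have [W WF tW] := far_ex X; have := none W; rewrite WF tW.
have [U0 U0F _] := far_ex 0%VS.
pose in2 (p : {vspace 'rV[K]_n} * {vspace 'rV[K]_n}) :=
  (p.1 \in Fam) && (p.2 \in Fam).
have in20 : in2 (U0, U0) by rewrite /in2 U0F.
have [[U1 U2] /andP [/= U1F U2F] maxU] :=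
  arg_maxnP (fun p => sdist p.1 p.2) in20.
have {}maxU A U : A \in Fam -> U \in Fam -> (sdist A U <= sdist U1 U2)%N.
  by move=> AF UF; apply: (maxU (A, U)); rewrite /in2 AF UF.
have D2t : (sdist U1 U2 <= 2 * t)%N.
  by apply: leq_trans hdiam; apply: sdist_le_sdiam.
set P := (U1 :&: U2)%VS; set T := (U1 + U2)%VS.
have PU1 : (P <= U1)%VS := capvSl _ _; have PU2 : (P <= U2)%VS := capvSr _ _.
have U1T : (U1 <= T)%VS := addvSl _ _; have U2T : (U2 <= T)%VS := addvSr _ _.
have PT := subv_trans PU1 U1T.
(* Both distances from [A] to [U1], [U2] are at most [sdist U1 U2], so the gate
   of [A] in the interval lies within half of that, i.e. within [t]. *)
have gate_near A : A \in Fam -> (sdist A (gate P T A) <= t)%N.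
  move=> AF; have := maxU _ _ AF U1F; have := maxU _ _ AF U2F.
  rewrite (sdist_gate A PU1 U1T) (sdist_gate A PU2 U2T).
  have := sdist_triangle (gate P T A) U1 U2; move: D2t; clear; lia.
pose I := [set X : {vspace 'rV[K]_n} | (P <= X)%VS && (X <= T)%VS].
(* At most [t] from [far X] to its gate, then at most [dim T - dim P = sdist U1 U2 <= 2 * t] inside
   the interval. *)
have far_le X : X \in I -> (sdist X (far X) <= 3 * t)%N.
  rewrite inE => /andP [PX XT]; have [WF _] := farP X.
  rewrite sdistC (sdist_gate _ PX XT).
  have := gate_near _ WF.
  have := sdist_interval (gate_ge P T (far X)) (gate_le (far X) PT) PX XT.
  by move: D2t; rewrite /sdist -/P -/T; clear; lia.
pose close X :=
  [set A in Fam | [exists Y in neighbours X (far X), (sdist A Y <= t - 1)%N]].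
(* If [A] is at distance exactly [t] from its gate [X], then [A] is at distance
   at most [2 t] from [far X], less than [sdist A X + sdist X (far X)], so some
   neighbour of [X] towards [far X] is closer to [A]. *)
have cover A : A \in Fam -> exists2 X, X \in I & A \in close X.
  move=> AF; exists (gate P T A); first by rewrite inE gate_ge gate_le.
  rewrite inE AF /=; set X := gate P T A; have AX := gate_near A AF.
  have [WF tW] := farP X; have AW := sdist_le_sdiam AF WF.
  have [Xnear|Xfar] := leqP (sdist A X) (t - 1).
    by apply/existsP; exists X; rewrite Xnear inE eqxx.
  have [|Y YN AY] := @closer_neighbour _ _ A X (far X).
    by move: AX AW tW Xfar hdiam; rewrite -/X; clear; lia.
  apply/existsP; exists Y; rewrite YN /=.
  by move: AX AY; rewrite -/X; clear; lia.
set Q : rat := q%:R; set g := gauss_binom q.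
have close_le X : X \in I ->
    (#|close X|%:R : rat) <= Q ^+ (3 * t) * (3 / 2 * g n (t - 1)%N).
  move=> XI; have g0 : 0 <= g n (t - 1)%N := gauss_ge0 q1 _ _.
  apply: (@le_trans _ _ (#|neighbours X (far X)|%:R * (3 / 2 * g n (t - 1)%N))).
    apply: (card_cover (C := fun Y =>
      [set A : {vspace 'rV[K]_n} | (sdist A Y <= t - 1)%N])).
      move=> A; rewrite inE => /andP [_ /existsP [Y /andP [YN AY]]].
      by exists Y => //; rewrite inE.
    move=> Y _; have := @card_ball K n Y (t - 1); rewrite hq.
    have -> : (4 * (t - 1) < n)%N by move: ht hn; clear; lia.
    by move=> /(_ isT); rewrite -/g; clear; lra.
  apply: ler_wpM2r; first by apply: mulr_ge0 g0.
  apply: le_trans (card_neighbours _ _) _; rewrite hq.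
  by apply: qX_le => //; apply: far_le.
have I_le : (#|I|%:R : rat) <= 3 * g (2 * t)%N t.
  rewrite card_interval // hq; exact: gauss_sum_total.
have gn_gt0 : 0 < g n (t - 1)%N by apply: gauss_gt0 => //; clear -ht hn; lia.
have g2_gt0 : 0 < g (2 * t)%N t by apply: gauss_gt0 => //; clear -ht hn; lia.
(* Source of the strict inequality: the term [i = 0] equals 1. *)
have sum_gt0 : 0 < \sum_(0 <= i < t) g n i.
  rewrite /g big_ltn ?gauss_n0; last by clear -ht hn; lia.
  by apply: ltr_pwDl => //; apply: sumr_ge0 => i _; apply: gauss_ge0.
have Fam_le := card_cover cover close_le.
have g3_ge : Q ^+ (t * t) * g (2 * t)%N t <= g (3 * t)%N t.
  rewrite (_ : 3 * t = t + 2 * t)%N; last by clear -ht hn; lia.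
  by apply: gauss_addN => //; clear -ht hn; lia.
(* The exponents compare because [(t - 1) * (t - 2) >= 0]. *)
have Q_le : Q ^+ (3 * t) <= Q ^+ 2 * Q ^+ (t * t).
  by rewrite -exprD qX_le //; clear -ht; nia.
have t_ge : (5 : rat) <= (2 * t + 1)%:R by rewrite (ler_nat _ 5); clear -ht; lia.
rewrite -[ltLHS]add0r; apply: ltr_leD sum_gt0 _.
apply: (final_estimate _ _ _ _ Fam_le I_le g3_ge Q_le t_ge).
- exact: ltW.
- exact: ltW.
- exact: exprn_ge0 (ler0n _ _).
- exact: exprn_ge0 (ler0n _ _).
Qed.
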